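(* Let $(\omega^1,\dots,\omega^8)$ be a coframe on an 8-dimensional manifold $M$ satisfying, for some functions $\tilde u_1,\dots,\tilde u_{12}$ on $M$, the structure equations (S) given in the context, and let $\theta^i=\sum_j A^i{}_j\omega^j$ with $A=(A^i{}_j)$ the most general element of the reduced structure group $G_0$ described in the context. Let $$E_2=d\theta^2-\Big(2\Omega_1\wedge\theta^2+2\Omega_3\wedge\theta^1-2\theta^5\wedge\theta^7+\sum_{i=1}^3\sum_{j=i+1}^8t^2{}_{ij}\theta^i\wedge\theta^j\Big),$$ $$E_3=d\theta^3-\Big(2\Omega_2\wedge\theta^1+2\Omega_4\wedge\theta^3-2\theta^4\wedge\theta^6+\sum_{i=1}^3\sum_{j=i+1}^8t^3{}_{ij}\theta^i\wedge\theta^j\Big),$$ where $\Omega_1,\dots,\Omega_4$ are 1-forms and $t^2{}_{ij},t^3{}_{ij}$ are functions (torsion coefficients). Then $$E_2\wedge\theta^1\wedge\theta^2\wedge\theta^4\wedge\theta^5\wedge\theta^7\wedge\theta^8=0\quad\text{iff}\quad t^2{}_{36}=\frac{a_{38}^2\,T}{a_{29}^3b_7(b_5b_6-1)^3},$$ and $$E_3\wedge\theta^1\wedge\theta^3\wedge\theta^4\wedge\theta^5\wedge\theta^6\wedge\theta^8=0\quad\text{iff}\quad t^3{}_{27}=\frac{a_{29}^2}{a_{38}^3b_7(b_5b_6-1)^3}\,T.$$ Here $$T=-\tilde u_8+(3\tilde u_5-2\tilde u_4)b_6+(6\tilde u_1-3\tilde u_6-\tilde u_{12})b_6^2+(\tilde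 u_7-6\tilde u_2+3\tilde u_9)b_6^3+(2\tilde u_3-3\tilde u_{10})b_6^4+\tilde u_{11}b_6^5 .$$
   Context: Structure equations (S): $$\begin{aligned} d\omega^1&=2 \tilde{u}_1 \omega^1\wedge\omega^6+2 \tilde{u}_2 \omega^1\wedge\omega^7+\tilde{u}_2 \omega^2\wedge\omega^6+\tilde{u}_3 \omega^2\wedge\omega^7+\tilde{u}_4 \omega^3\wedge\omega^6+\tilde{u}_1 \omega^3\wedge\omega^7-\omega^4\wedge\omega^7-\omega^5\wedge\omega^6,\\ d\omega^2&=2 \tilde{u}_5 \omega^1\wedge\omega^6+2 \tilde{u}_6 \omega^1\wedge\omega^7+\tilde{u}_6 \omega^2\wedge\omega^6+\tilde{u}_7 \omega^2\wedge\omega^7+\tilde{u}_8 \omega^3\wedge\omega^6+\tilde{u}_5 \omega^3\wedge\omega^7-2 \omega^5\wedge\omega^7,\\ d\omega^3&=2 \tilde{u}_9 \omega^1\wedge\omega^6+2 \tilde{u}_{10} \omega^1\wedge\omega^7+\tilde{u}_{10} \omega^2\wedge\omega^6+\tilde{u}_{11} \omega^2\wedge\omega^7+\tilde{u}_{12} \omega^3\wedge\omega^6+\tilde{u}_9 \omega^3\wedge\omega^7-2 \omega^4\wedge\omega^6,\\ d\omega^4&=\omega^6\wedge\omega^8,\quad d\omega^5=\omega^7\wedge\omega^8,\quad d\omega^6=d\omega^7=d\omega^8=0. \end{aligned}$$ The reduced structure group $G_0$ consists of all $8\times8$ real matrices $$\begin{pmatrix} a_{29}a_{38}a_{49}(1+b_5b_6)b_7^2&a_{29}a_{38}a_{49}b_5b_7^2&a_{29}a_{38}a_{49}b_6b_7^2&0&0&0&0&0\\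 2a_{38}^2a_{49}b_6b_7^2&a_{38}^2a_{49}b_7^2&a_{38}^2a_{49}b_6^2b_7^2&0&0&0&0&0\\ 2a_{29}^2a_{49}b_5b_7^2&a_{29}^2a_{49}b_5^2b_7^2&a_{29}^2a_{49}b_7^2&0&0&0&0&0\\ a_{16}&a_{17}&a_{18}&a_{29}a_{49}b_7&a_{29}a_{49}b_5b_7&0&0&0\\ a_{21}&a_{22}&a_{23}&a_{38}a_{49}b_6b_7&a_{38}a_{49}b_7&0&0&0\\ a_{26}&a_{27}&a_{28}&a_{29}&a_{29}b_5&a_{29}b_7&a_{29}b_5b_7&0\\ a_{34}&a_{35}&a_{36}&a_{38}b_6&a_{38}&a_{38}b_6b_7&a_{38}b_7&0\\ a_{42}&a_{43}&a_{44}&a_{45}&a_{46}&0&0&a_{49} \end{pmatrix}$$ with 23 real parameters $a_{16},a_{17},a_{18},a_{21},a_{22},a_{23},a_{26},a_{27},a_{28},a_{29},a_{34},a_{35},a_{36},a_{38},a_{42},a_{43},a_{44},a_{45},a_{46},a_{49},b_5,b_6,b_7$ subject to nonvanishing determinant, i.e. $a_{29}a_{38}a_{49}b_7(1-b_5b_6)\neq0$. The parameters are coordinates on $G_0$, and the forms $\theta^i$ live on $M\times G_0$ (forms and functions on $M$ are pulled back). The quintic $T=T(b_6)$ is called the main invariant of the system.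
   Formalization: In the second equivalence the factor T=T(b_6) is replaced by -b_5^5 T(1/b_5), written out as a polynomial in b_5 (T under the exchange 2-3, 4-5, 6-7, b_5-b_6); the printed formula fails, e.g. for u_11=1, all other u=0, at b_5=b_6=0. *)

(* Defs.v *)
From HB Require Import structures.
From mathcomp Require Import all_boot all_order all_algebra.
From mathcomp Require Import all_fingroup.
From mathcomp Require Import all_classical all_reals all_analysis.
From mathcomp Require Import ring.

Set Implicit Arguments.
Unset Strict Implicit.
Unset Printing Implicit Defensive.

Import Order.TTheory GRing.Theory Num.Theory.
Import numFieldNormedType.Exports.

Local Open Scope classical_set_scope.
Local Open Scope ring_scope.

Section SmoothFunctions.
Variables (R : realType) (V W : normedModType R).

(* For an open subset U of a finite-dimensional V, these are the classical
   C^k and C^infinity: all iterated directional (in particular partial)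
   derivatives up to order k exist on U and those of order k are continuous. *)
Fixpoint Ck_on (k : nat) (U : set V) (f : V -> W) : Prop :=
  if k is k'.+1 then
    (forall y v, U y -> derivable f y v) /\
    (forall v, Ck_on k' U (fun y => 'D_v f y))
  else forall y, U y -> {for y, continuous f}.

Definition smooth_on (U : set V) (f : V -> W) : Prop := forall k, Ck_on k U f.

End SmoothFunctions.

(* [toR c] is only meaningful on [dom c], and [fromR c] on its image. *)
Record atlas (R : realType) (n : nat) (M : Type) := Atlas {
  chart : Type;
  dom : chart -> set M;
  toR : chart -> M -> 'rV[R]_n;
  fromR : chart -> 'rV[R]_n -> M }.

Section Manifolds.
Variables (R : realType) (n : nat) (M : Type) (A : atlas R n M).
Implicit Types c : chart A.

Definition img c : set 'rV[R]_n := toR c @` dom c.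

Definition transition c c' : 'rV[R]_n -> 'rV[R]_n :=
  fun y => toR c' (fromR c y).

Definition carrier : set M := \bigcup_(c in [set: chart A]) dom c.

Definition smooth_fun (f : M -> R) : Prop :=
  forall c, smooth_on (img c) ((fun y => f (fromR c y)) : 'rV[R]_n -> R^o).

(* Equality of functions defined on [carrier]. *)
Definition eq_on_carrier (f g : M -> R) : Prop := forall p, carrier p -> f p = g p.

End Manifolds.

Record smooth_manifold (R : realType) (n : nat) (M : topologicalType)
    (A : atlas R n M) : Prop := SmoothManifold {
  manifold_hausdorff : hausdorff_space M;
  manifold_second_countable : @second_countable M;
  chart_cover : forall p : M, carrier A p;
  chart_open : forall c : chart A, open (dom c);
  chart_img_open : forall c : chart A, open (img c);
  chart_cancel : forall c : chart A, {in dom c, cancel (toR c) (fromR c)};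
  chart_continuous : forall c : chart A, {within dom c, continuous (toR c)};
  chart_inv_continuous :
    forall c : chart A, {within img c, continuous (fromR c)};
  transition_smooth : forall c c' : chart A,
    smooth_on (toR c @` (dom c `&` dom c')) (transition c c') }.

Section Forms.
Variables (R : realType) (n : nat) (M : Type) (A : atlas R n M).

(* [a c p v] is the value of the k-form [a] at the point [p] (in [dom c]) on
   the k tangent vectors whose coordinates in the chart [c] are the rows of
   [v].  Arbitrary elements of this type are just families of functions; those
   that are differential forms are singled out by [is_dform]. *)
Definition dform (k : nat) : Type := chart A -> M -> 'M[R]_(k, n) -> R.

Definition multilinear k (f : 'M[R]_(k, n) -> R) : Prop :=
  forall (i : 'I_k) (b c : R) (v w x : 'M[R]_(k, n)),
    row i v = b *: row i w + c *: row i x ->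
    row' i v = row' i w -> row' i v = row' i x ->
    f v = b * f w + c * f x.

Definition alternating k (f : 'M[R]_(k, n) -> R) : Prop :=
  forall (i j : 'I_k) (v : 'M[R]_(k, n)),
    i != j -> row i v = row j v -> f v = 0.

(* Change of coordinates of k tangent vectors at [p], from [c] to [c']. *)
Definition change_coord k (c c' : chart A) (p : M) (v : 'M[R]_(k, n)) :
    'M[R]_(k, n) :=
  \matrix_(i < k) 'D_(row i v) (transition c c') (toR c p).

Definition is_dform k (a : dform k) : Prop :=
  [/\ forall c p, dom c p -> multilinear (a c p) /\ alternating (a c p),
      forall c c' p v, dom c p -> dom c' p ->
        a c' p (change_coord c c' p v) = a c p v
    & forall c v, smooth_on (img c)
        ((fun y => a c (fromR c y) v) : 'rV[R]_n -> R^o)].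

HB.instance Definition _ k := GRing.Zmodule.copy (dform k)
  (chart A -> M -> 'M[R]_(k, n) -> R).

Definition eq_dform k (a b : dform k) : Prop :=
  forall c p v, dom c p -> a c p v = b c p v.

Definition scalef k (f : M -> R) (a : dform k) : dform k :=
  fun c p v => f p * a c p v.

Definition wedge k l (a : dform k) (b : dform l) : dform (k + l) :=
  fun c p v => (k`! * l`!)%:R^-1 *
    \sum_(s : 'S_(k + l)) (-1) ^+ s *
       (a c p (usubmx (row_perm s v)) * b c p (dsubmx (row_perm s v))).

(* The invariant formula for d, applied to vector fields that are constant in
   the chart, so that the terms with Lie brackets vanish. *)
Definition extd k (a : dform k) : dform k.+1 :=
  fun c p v => \sum_(i < k.+1) ((-1) ^+ i : R) *
    ('D_(row i v) ((fun y => a c (fromR c y) (row' i v)) : 'rV[R]_n -> R^o)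
      (toR c p) : R).

Definition coframe (w : 'I_n -> dform 1) : Prop :=
  (forall i, is_dform (w i)) /\
  (forall c p, dom c p ->
     \matrix_(i < n, j < n) w i c p (delta_mx 0 j) \in unitmx).

End Forms.

Notation "a ∧ b" := (wedge a b) (at level 38, left associativity) : ring_scope.
Notation "f ⋅ a" := (scalef f a) (at level 39, left associativity) : ring_scope.
Notation "a =f b" := (eq_dform a b) (at level 70).

(* The index written k in 1-based notation. *)
Definition ix (n k : nat) : 'I_n.+1 := inord k.-1.
Arguments ix {n} k.

Section StructureEquations.
Variables (R : realType) (M : Type) (A : atlas R 8 M).
Variables (u : 'I_12 -> M -> R) (w : 'I_8 -> dform A 1).

Local Notation U k := (u (ix k)).
Local Notation ω k := (w (ix k)).
Local Notation d := (@extd _ _ _ _ 1).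

Definition structure_equations : Prop :=
  [/\ d (ω 1) =f U 1 ⋅ ω 1 ∧ ω 6 *+ 2 + U 2 ⋅ ω 1 ∧ ω 7 *+ 2
               + U 2 ⋅ ω 2 ∧ ω 6 + U 3 ⋅ ω 2 ∧ ω 7
               + U 4 ⋅ ω 3 ∧ ω 6 + U 1 ⋅ ω 3 ∧ ω 7
               - ω 4 ∧ ω 7 - ω 5 ∧ ω 6,
      d (ω 2) =f U 5 ⋅ ω 1 ∧ ω 6 *+ 2 + U 6 ⋅ ω 1 ∧ ω 7 *+ 2
               + U 6 ⋅ ω 2 ∧ ω 6 + U 7 ⋅ ω 2 ∧ ω 7
               + U 8 ⋅ ω 3 ∧ ω 6 + U 5 ⋅ ω 3 ∧ ω 7
               - ω 5 ∧ ω 7 *+ 2,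
      d (ω 3) =f U 9 ⋅ ω 1 ∧ ω 6 *+ 2 + U 10 ⋅ ω 1 ∧ ω 7 *+ 2
               + U 10 ⋅ ω 2 ∧ ω 6 + U 11 ⋅ ω 2 ∧ ω 7
               + U 12 ⋅ ω 3 ∧ ω 6 + U 9 ⋅ ω 3 ∧ ω 7
               - ω 4 ∧ ω 6 *+ 2,
      d (ω 4) =f ω 6 ∧ ω 8 /\ d (ω 5) =f ω 7 ∧ ω 8
    & [/\ d (ω 6) =f 0, d (ω 7) =f 0 & d (ω 8) =f 0]].

End StructureEquations.

Section ReducedGroup.
Variable R : realType.
Implicit Type x : 'rV[R]_23.

(* The 23 group parameters, in the order in which they occur in [x]. *)
Definition a16 x := x 0 (ix 1).
Definition a17 x := x 0 (ix 2).
Definition a18 x := x 0 (ix 3).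
Definition a21 x := x 0 (ix 4).
Definition a22 x := x 0 (ix 5).
Definition a23 x := x 0 (ix 6).
Definition a26 x := x 0 (ix 7).
Definition a27 x := x 0 (ix 8).
Definition a28 x := x 0 (ix 9).
Definition a29 x := x 0 (ix 10).
Definition a34 x := x 0 (ix 11).
Definition a35 x := x 0 (ix 12).
Definition a36 x := x 0 (ix 13).
Definition a38 x := x 0 (ix 14).
Definition a42 x := x 0 (ix 15).
Definition a43 x := x 0 (ix 16).
Definition a44 x := x 0 (ix 17).
Definition a45 x := x 0 (ix 18).
Definition a46 x := x 0 (ix 19).
Definition a49 x := x 0 (ix 20).
Definition b5 x := x 0 (ix 21).
Definition b6 x := x 0 (ix 22).
Definition b7 x := x 0 (ix 23).

Definition G0_mx x : 'M[R]_8 :=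
  let a29 := a29 x in let a38 := a38 x in let a49 := a49 x in
  let b5 := b5 x in let b6 := b6 x in let b7 := b7 x in
  \matrix_(i < 8, j < 8) nth 0 (nth [::] [::
    [:: a29 * a38 * a49 * (1 + b5 * b6) * b7 ^+ 2;
        a29 * a38 * a49 * b5 * b7 ^+ 2;
        a29 * a38 * a49 * b6 * b7 ^+ 2;
        0; 0; 0; 0; 0];
    [:: 2 * a38 ^+ 2 * a49 * b6 * b7 ^+ 2;
        a38 ^+ 2 * a49 * b7 ^+ 2;
        a38 ^+ 2 * a49 * b6 ^+ 2 * b7 ^+ 2;
        0; 0; 0; 0; 0];
    [:: 2 * a29 ^+ 2 * a49 * b5 * b7 ^+ 2;
        a29 ^+ 2 * a49 * b5 ^+ 2 * b7 ^+ 2;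
        a29 ^+ 2 * a49 * b7 ^+ 2;
        0; 0; 0; 0; 0];
    [:: a16 x; a17 x; a18 x;
        a29 * a49 * b7; a29 * a49 * b5 * b7; 0; 0; 0];
    [:: a21 x; a22 x; a23 x;
        a38 * a49 * b6 * b7; a38 * a49 * b7; 0; 0; 0];
    [:: a26 x; a27 x; a28 x;
        a29; a29 * b5; a29 * b7; a29 * b5 * b7; 0];
    [:: a34 x; a35 x; a36 x;
        a38 * b6; a38; a38 * b6 * b7; a38 * b7; 0];
    [:: a42 x; a43 x; a44 x; a45 x; a46 x; 0; 0; a49]] i) j.

(* The domain of the global coordinates of G_0:
   \det (G0_mx x) = a29^5 a38^5 a49^6 b7^10 (1 - b5 b6)^5. *)
Definition G0 : set 'rV[R]_23 :=
  [set x | a29 x * a38 x * a49 x * b7 x * (1 - b5 x * b6 x) != 0].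

End ReducedGroup.

Section Product.
Variables (R : realType) (M : Type) (A : atlas R 8 M).

(* The atlas of M x G_0 (as a subset of M x R^23) given by the charts of M
   and the global coordinates of G_0. *)
Definition atlasG0 : atlas R (8 + 23) (M * 'rV[R]_23) :=
  @Atlas R (8 + 23) (M * 'rV[R]_23)%type (chart A)
    (fun c => dom c `*` @G0 R)
    (fun c q => row_mx (toR c q.1) q.2)
    (fun c y => (fromR c (lsubmx y), rsubmx y)).

Definition pullback k (a : dform A k) : dform atlasG0 k :=
  fun c q v => a c q.1 (lsubmx v).

Definition lifted_coframe (w : 'I_8 -> dform A 1) (i : 'I_8) : dform atlasG0 1 :=
  (\sum_(j < 8) (fun q : M * 'rV[R]_23 => G0_mx q.2 i j) ⋅ pullback (w j)).

Variable th : 'I_8 -> dform atlasG0 1.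
Variables (Om : 'I_4 -> dform atlasG0 1).
Variable t : 'I_8 -> 'I_8 -> M * 'rV[R]_23 -> R.

Local Notation θ k := (th (ix k)).
Local Notation Ω k := (Om (ix k)).

(* 0-based, so i < 3 and i < j < 8 stand for 1 <= i <= 3 and i+1 <= j <= 8. *)
Definition torsion : dform atlasG0 2 :=
  (\sum_(i < 8 | (i < 3)%N) \sum_(j < 8 | (i < j)%N) t i j ⋅ th i ∧ th j).

Definition E2 : dform atlasG0 2 :=
  (extd (θ 2) - (Ω 1 ∧ θ 2 *+ 2 + Ω 3 ∧ θ 1 *+ 2 - θ 5 ∧ θ 7 *+ 2 + torsion)).

Definition E3 : dform atlasG0 2 :=
  (extd (θ 3) - (Ω 2 ∧ θ 1 *+ 2 + Ω 4 ∧ θ 3 *+ 2 - θ 4 ∧ θ 6 *+ 2 + torsion)).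

End Product.

Section MainInvariant.
Variables (R : realType) (u : 'I_12 -> R).

Local Notation U k := (u (ix k)).

(* The main invariant is [quintic b6]. *)
Definition quintic (b : R) : R :=
  - U 8 + (3 * U 5 - 2 * U 4) * b + (6 * U 1 - 3 * U 6 - U 12) * b ^+ 2
  + (U 7 - 6 * U 2 + 3 * U 9) * b ^+ 3 + (2 * U 3 - 3 * U 10) * b ^+ 4
  + U 11 * b ^+ 5.

(* The image of [quintic] under the symmetry of the problem that exchanges the
   coframe indices 2 and 3, 4 and 5, 6 and 7, and the parameters b5 and b6,
   a29 and a38.  It is the same quintic in the reciprocal variable, see
   [quintic_dualE], and it is evaluated at b5. *)
Definition quintic_dual (b : R) : R :=
  - U 11 + (3 * U 10 - 2 * U 3) * b + (6 * U 2 - 3 * U 9 - U 7) * b ^+ 2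
  + (U 12 - 6 * U 1 + 3 * U 6) * b ^+ 3 + (2 * U 4 - 3 * U 5) * b ^+ 4
  + U 8 * b ^+ 5.

Lemma quintic_dualE (b : R) : b != 0 -> quintic_dual b = - b ^+ 5 * quintic b^-1.
Proof. by move=> b0; rewrite /quintic_dual /quintic; field. Qed.

End MainInvariant.

(* Main.v *)
From mathcomp Require Import perm.
Require Import Defs.
From mathcomp Require Import all_boot all_order all_algebra.
From mathcomp Require Import all_classical all_reals all_analysis.
From mathcomp Require Import ring.

Set Implicit Arguments.
Unset Strict Implicit.
Unset Printing Implicit Defensive.

Import Order.TTheory GRing.Theory Num.Theory.
Import numFieldNormedType.Exports.

Local Open Scope classical_set_scope.
Local Open Scope ring_scope.

(** Both equivalences are pointwise: at a point of M x G_0, the 8-form is the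
    wedge of a 2-form E with six members of the lifted coframe, and the coframe
    is linearly independent.  Such a wedge depends only on the restriction of E
    to the common kernel K of the six covectors.  If the two other covectors
    are theta^a and theta^b, and E = c theta^a ∧ theta^b on K, then the 8-form is
    c times the wedge of eight independent covectors, hence vanishes if and only
    if c = 0 ([wedges_eq0]).  It remains to find c.

    Take E_2, where K is the kernel of theta^1, theta^2, theta^4, theta^5,
    theta^7, theta^8.  The terms with Omega_1, Omega_3, theta^5 and all torsion
    terms except t_36 vanish on K, which leaves d theta^2 - t_36 theta^3 ∧ theta^6.
    Put h = a38^2 a49 b7^2.  Then theta^2 = h (2 b6 omega^1 + omega^2 + b6^2
    omega^3), so d theta^2 has two parts.
    - The derivatives of the coefficients do not contribute.  On K the
      coframe satisfies omega^1 = - b6 omega^3 and omega^2 = b6^2 omega^3, where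
      (- b6, b6^2, 1) are fixed numbers, and the pairing of (2 b, 1, b^2) with
      this vector is (b - b6)^2, which has a double zero at b = b6
      ([diff_at_quadric]).
    - In 2 b6 d omega^1 + d omega^2 + b6^2 d omega^3, the structure equations
      leave a multiple of omega^3 ∧ omega^6, because on K the forms omega^1,
      omega^2, omega^4, omega^5 are multiples of omega^3 and omega^7 equals
      - b6 omega^6 up to a multiple of omega^3 ([lifted_kernel2]).  The factor is
      - T(b6) ([extd_kernel2]).
    Comparing with theta^3 ∧ theta^6 = a29^3 a49 b7^3 (1 - b5 b6)^3 omega^3 ∧ omega^6
    on K ([lifted_wedge_kernel2]) gives c as the difference between the claimed
    value and t_36 ([E2_kernel]).

    The second equivalence is the image of the first under the exchange of
    the indices 2 and 3, 4 and 5, 6 and 7 and of the parameters b5 and b6, a29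
    and a38. *)

(** * Wedge products at a point *)
Section PointwiseForms.
Variables (R : realType) (n : nat).

(** The value of a k-form at a point in a chart; at that point the wedge product
    of differential forms is convertible to [pwedge]. *)
Definition pform (k : nat) : Type := 'M[R]_(k, n) -> R.

Definition pwedge k l (a : pform k) (b : pform l) : pform (k + l) :=
  fun v => (k`! * l`!)%:R^-1 *
    \sum_(s : 'S_(k + l)) (-1) ^+ s *
       (a (usubmx (row_perm s v)) * b (dsubmx (row_perm s v))).

(** The wedge product of the first k covectors of the list. *)
Definition detform k (s : seq (pform 1)) : pform k :=
  fun v => \det (\matrix_(i < k, j < k) nth (fun=> 0) s j (row i v)).

Section ExtendPerm.
Variable k : nat.
Implicit Type t : 'S_k.

Definition extend_fun t (i : 'I_(k + 1)) : 'I_(k + 1) :=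
  match fintype.split i with inl j => lshift 1 (t j) | inr j => rshift k j end.

Lemma extend_funK t : cancel (extend_fun t) (extend_fun t^-1).
Proof.
move=> i; rewrite /extend_fun -[i in RHS]splitK.
by case: (fintype.split i) => j; rewrite (unsplitK (inl _), unsplitK (inr _)) ?permK.
Qed.

Definition extend_perm t : 'S_(k + 1) := perm (can_inj (extend_funK t)).

Lemma extend_perml t j : extend_perm t (lshift 1 j) = lshift 1 (t j).
Proof. by rewrite permE /extend_fun (unsplitK (inl _)). Qed.

Lemma extend_permr t j : extend_perm t (rshift k j) = rshift k j.
Proof. by rewrite permE /extend_fun (unsplitK (inr _)). Qed.

(** A sign is the determinant of a permutation matrix, which is block diagonal
    here. *)
Lemma sign_extend_perm t : (-1) ^+ extend_perm t = (-1) ^+ t :> R.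
Proof.
rewrite -!det_perm; have -> : perm_mx (extend_perm t) =
    block_mx (perm_mx t) 0 0 1%:M :> 'M[R]_(k + 1).
  apply/matrixP=> i j; rewrite !mxE.
  case: (split_ordP i) => i' ->; rewrite ?extend_perml ?extend_permr !mxE;
    case: (split_ordP j) => j' ->;
    by rewrite !mxE ?eq_lshift ?eq_rshift ?eq_lrshift ?eq_rlshift.
by rewrite det_ublock det1 mulr1.
Qed.

End ExtendPerm.

(** Leibniz expansion of the inner determinant gives one sum over 'S_(k + 1) for
    each p in 'S_k.  Translation by the extension of p turns every one of these
    k! sums into the large determinant, and the normalization k! cancels. *)
Lemma pwedge_det k (s : seq (pform 1)) (t : pform 1) : size s = k ->
  pwedge (@detform k s) t = @detform (k + 1) (rcons s t).
Proof.
move=> sk; apply/funext=> v; rewrite /pwedge.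
set d := detform _ v.
suff H (p : 'S_k) : \sum_(s0 : 'S_(k + 1)) (-1) ^+ s0 * ((-1) ^+ p *
    (\prod_(i < k) nth (fun=> 0) s (p i) (row (s0 (lshift 1 i)) v)) *
    t (row (s0 (rshift k 0)) v)) = d.
  under eq_bigr => s0 _.
    have -> : detform s (usubmx (row_perm s0 v)) = \sum_(p : 'S_k) (-1) ^+ p *
        \prod_(i < k) nth (fun=> 0) s (p i) (row (s0 (lshift 1 i)) v).
      rewrite /detform /determinant; apply: eq_bigr => p _.
      congr (_ * _); apply: eq_bigr => i _; rewrite mxE; congr (nth _ _ _ _).
      by apply/rowP=> j; rewrite !mxE.
    have -> : dsubmx (row_perm s0 v) = row (s0 (rshift k 0)) v.
      by apply/rowP=> j; rewrite !mxE; congr (v (s0 _) _); apply: val_inj.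
    rewrite mulr_suml mulr_sumr.
    over.
  rewrite exchange_big /= (eq_bigr (fun=> d)) => [|p _]; last exact: H.
  rewrite sumr_const card_Sn [1`!]/= muln1 -(mulr_natl d) mulKf //.
rewrite (reindex_inj (mulgI (extend_perm p)%g)) /=.
rewrite /d /detform -det_tr /determinant; apply: eq_bigr => s0 _.
rewrite odd_permM signr_addb sign_extend_perm -[X in _ * X]mulrA mulrACA.
rewrite -expr2 sqrr_sign mul1r.
congr (_ * _); rewrite big_split_ord /= big_ord1; congr (_ * _).
  rewrite [RHS](reindex_perm p) /=; apply: eq_bigr => i _.
  by rewrite !mxE permM extend_perml nth_rcons /= sk ltn_ord.
by rewrite !mxE permM extend_permr nth_rcons /= sk addn0 ltnn eqxx.
Qed.

(** k + m, computed as k + 1 + ... + 1, so that [wedges] of an explicit list is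
    convertible to the iterated wedge product. *)
Fixpoint wdim k m : nat := if m is m'.+1 then wdim (k + 1) m' else k.

Lemma wdimE k m : wdim k m = (k + m)%N.
Proof. by elim: m k => [|m IH] k /=; rewrite ?addn0 // IH -addnA. Qed.

Fixpoint wedges k (a : pform k) (s : seq (pform 1)) : pform (wdim k (size s)) :=
  match s return pform (wdim k (size s)) with
  | [::] => a
  | t :: s' => @wedges _ (pwedge a t) s'
  end.
Arguments wedges {k} a s _.

Lemma wedges_det k (r s : seq (pform 1)) : size r = k ->
  wedges (@detform k r) s = @detform _ (r ++ s).
Proof.
elim: s k r => [|t s IH] k r rk /=; first by rewrite cats0.
by rewrite pwedge_det // IH ?cat_rcons // size_rcons rk addn1.
Qed.

Lemma wedges_linear k (a b : pform k) c (s : seq (pform 1)) v :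
  wedges (fun x => c * a x + b x) s v = c * wedges a s v + wedges b s v.
Proof.
elim: s k a b v => [|t s IH] k a b v //=.
suff -> : pwedge (fun x => c * a x + b x) t =
    fun x => c * pwedge a t x + pwedge b t x by rewrite IH.
apply/funext => x; rewrite /pwedge mulrCA -mulrDr; congr (_ * _).
rewrite mulr_sumr -big_split; apply: eq_bigr => p _ /=.
by rewrite mulrDl mulrDr -[c * _ * _]mulrA [in LHS]mulrCA.
Qed.

Lemma detform_repeat k (s : seq (pform 1)) i j v :
  (i < j < k)%N -> nth (fun=> 0) s i = nth (fun=> 0) s j -> @detform k s v = 0.
Proof.
move=> /andP[ij jk] sij; have ik := ltn_trans ij jk.
rewrite /detform -det_tr.
apply: (@determinant_alternate _ _ _ (Ordinal ik) (Ordinal jk)) => [|l].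
  by rewrite -val_eqE /= ltn_eqF.
by rewrite !mxE /= sij.
Qed.

Lemma row0_col_mx (x y : 'M[R]_(1, n)) : row (0 : 'I_2) (col_mx x y) = x.
Proof.
apply/rowP=> j; rewrite mxE -[RHS](col_mxEu x y).
by congr (col_mx x y _ _); apply/val_inj.
Qed.

Lemma row1_col_mx (x y : 'M[R]_(1, n)) : row (1 : 'I_2) (col_mx x y) = y.
Proof.
apply/rowP=> j; rewrite mxE -[RHS](col_mxEd x y).
by congr (col_mx x y _ _); apply/val_inj.
Qed.

Lemma detform1 (a : pform 1) : @detform 1 [:: a] = a.
Proof.
apply/funext=> v; rewrite /detform det_mx11 mxE /=; congr a.
by apply/rowP=> j; rewrite mxE.
Qed.

Lemma pwedge11_det (a b : pform 1) : pwedge a b = @detform 2 [:: a; b].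
Proof. by rewrite -{1}[a]detform1 pwedge_det. Qed.

Lemma pwedge11 (a b : pform 1) x y :
  pwedge a b (col_mx x y) = a x * b y - a y * b x.
Proof.
rewrite pwedge11_det /detform (expand_det_row _ ord0) !big_ord_recl big_ord0 addr0.
rewrite /cofactor !det_mx11 !mxE /=.
have -> : lift ord0 ord0 = 1 :> 'I_2 by apply/val_inj.
have -> : ord0 = 0 :> 'I_2 by apply/val_inj.
by rewrite row0_col_mx row1_col_mx /=; ring.
Qed.

(** Alternating bilinear forms, on pairs of vectors stacked as the two rows of a
    matrix. *)
Definition alt2 (f : pform 2) : Prop :=
  (forall c (x y z : 'rV[R]_n),
     f (col_mx (c *: x + y) z) = c * f (col_mx x z) + f (col_mx y z))
  /\ (forall x y : 'rV[R]_n, f (col_mx y x) = - f (col_mx x y)).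

Definition lin1 (t : pform 1) := forall c x y, t (c *: x + y) = c * t x + t y.

Lemma alt2_scaleD c f g : alt2 f -> alt2 g -> alt2 (fun v => c * f v + g v).
Proof.
move=> [f1 f2] [g1 g2]; split=> [b x y z|x y]; first by rewrite f1 g1; ring.
by rewrite f2 g2; ring.
Qed.

Lemma alt2_pwedge a b : lin1 a -> lin1 b -> alt2 (pwedge a b).
Proof.
by move=> la lb; split=> [c x y z|x y]; rewrite !pwedge11 ?la ?lb; ring.
Qed.

Lemma col_mx_row2 (v : 'M[R]_(2, n)) : v = col_mx (row 0 v) (row 1 v) :> 'M[R]_(1 + 1, n).
Proof.
apply/matrixP => i j; case: (split_ordP i) => k ->.
  by rewrite col_mxEu mxE ord1; congr (v _ _); apply/val_inj.
by rewrite col_mxEd mxE ord1; congr (v _ _); apply/val_inj.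
Qed.

Section Dual.
Variables (I : eqType) (th : I -> pform 1) (e : I -> 'rV[R]_n).
Hypothesis th_lin : forall i, lin1 (th i).
Hypothesis th_dual : forall i j, th i (e j) = (i == j)%:R.

Lemma lin1B t x c y : lin1 t -> t (x - c *: y) = t x - c * t y.
Proof. by move=> lt; rewrite addrC -scaleNr lt; ring. Qed.

(** f and its composite with the projection along e_i onto the kernel of th_i
    differ by th_i ∧ f(e_i, -), which the factor th_i of the product kills. *)
Lemma wedges_mod (s : seq I) i f v : alt2 f -> i \in s ->
  wedges f [seq th j | j <- s] v =
  wedges (fun v : 'M[R]_(2, n) => f (col_mx (row 0 v - th i (row 0 v) *: e i)
                          (row 1 v - th i (row 1 v) *: e i)))
    [seq th j | j <- s] v.
Proof.
move=> [f1 f2] si.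
set g : pform 2 := (X in _ = wedges X _ _).
have f2' (x y z : 'rV[R]_n) c :
    f (col_mx z (c *: x + y)) = c * f (col_mx z x) + f (col_mx z y).
  by rewrite f2 f1 (f2 x z) (f2 y z); ring.
have fee (x : 'rV[R]_n) : f (col_mx x x) = 0.
  have := f2 x x; set a := f _ => /eqP; rewrite -addr_eq0 -mulr2n mulrn_eq0.
  by move=> /eqP.
pose b : pform 1 := fun y => f (col_mx (e i) y).
have -> : f = fun v => 1 * pwedge (th i) b v + g v.
  apply/funext=> x; rewrite [x]col_mx_row2 pwedge11 /g row0_col_mx row1_col_mx /b.
  set X := row 0 x; set Y := row 1 x.
  rewrite [X - _]addrC [Y - _]addrC -!(scaleNr _ (e i)) f1 !f2' fee (f2 (e i) X).
  by ring.
rewrite wedges_linear mul1r pwedge11_det wedges_det //.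
rewrite (@detform_repeat _ _ 0 (index i s).+2) ?add0r //=.
  by rewrite wdimE size_map addnC addn2 !ltnS index_mem.
by rewrite (nth_map i) ?index_mem // nth_index.
Qed.

(** Composing f with the projections onto the kernels of the th_i, i in L, one
    after the other, leaves the product unchanged and ends with f = 0. *)
Lemma wedges_vanish (s L : seq I) f : {subset L <= s} -> uniq L -> alt2 f ->
  (forall x y, {in L, forall i, th i x = 0} -> {in L, forall i, th i y = 0} ->
    f (col_mx x y) = 0) ->
  forall v, wedges f [seq th i | i <- s] v = 0.
Proof.
elim: L f => [|i L IH] f Ls uL af f0 v.
  (* Here f = 0, so that f = - f + f and the claim follows by linearity. *)
  have -> : f = fun v => (-1) * f v + f v.
    by apply/funext=> x; rewrite [x]col_mx_row2 f0 //; ring.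
  by rewrite wedges_linear mulN1r addNr.
case/andP: uL => iL uL.
rewrite (@wedges_mod _ i) ?Ls ?mem_head //; apply: IH => //.
- by move=> j jL; apply: Ls; rewrite in_cons jL orbT.
- case: af => f1 f2; split=> [c x y z|x y]; rewrite !row0_col_mx !row1_col_mx //.
  rewrite -f1 th_lin; congr f; congr (@col_mx _ 1 1 n _ _).
  by apply/rowP=> j; rewrite !mxE; ring.
- move=> x y x0 y0; rewrite !row0_col_mx !row1_col_mx.
  have K z : {in L, forall j, th j z = 0} ->
    {in i :: L, forall j, th j (z - th i z *: e i) = 0}.
    move=> z0 j; rewrite in_cons lin1B // th_dual => /predU1P[->|jL].
      by rewrite eqxx mulr1 subrr.
    rewrite z0 // (_ : j == i = false) ?mulr0 ?subr0 //.
    by apply: contraNF iL => /eqP <-.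
  by apply: f0; exact: K.
Qed.

Lemma detform_dual i0 (s : seq I) k : size s = k -> uniq s ->
  detform [seq th i | i <- s] (\matrix_(i < k) e (nth i0 s i)) = 1.
Proof.
move=> sk us; rewrite /detform -[RHS](det1 R k); congr (\det _).
apply/matrixP => i j; rewrite !mxE (nth_map i0) ?sk // rowK th_dual.
by rewrite nth_uniq ?sk // eq_sym.
Qed.

(** By [wedges_vanish], f may be replaced by c th_a ∧ th_b in the product, which
    becomes c times a determinant of value 1 on the dual vectors. *)
Lemma wedges_eq0 (a b : I) (s : seq I) f c : uniq [:: a, b & s] -> alt2 f ->
  (forall x y, {in s, forall i, th i x = 0} -> {in s, forall i, th i y = 0} ->
    f (col_mx x y) = c * (th a x * th b y - th a y * th b x)) ->
  (forall v, wedges f [seq th i | i <- s] v = 0) <-> c = 0.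
Proof.
move=> us af fK.
pose g : pform 2 := pwedge (th a) (th b).
pose h : pform 2 := fun v => - c * g v + f v.
have h0 v : wedges h [seq th i | i <- s] v = 0.
  apply: (@wedges_vanish s s) => //; first by case/and3P: us.
    by apply: alt2_scaleD => //; apply: alt2_pwedge.
  by move=> x y x0 y0; rewrite /h /g fK // pwedge11; ring.
have W v : wedges f [seq th i | i <- s] v =
    c * detform [seq th i | i <- [:: a, b & s]] v.
  have -> : f = fun v => c * g v + h v by apply/funext=> x; rewrite /h; ring.
  by rewrite wedges_linear h0 addr0 /g pwedge11_det wedges_det.
split=> [W0|c0 v]; last by rewrite W c0 mul0r.
have := W0 (\matrix_(i < _) e (nth a [:: a, b & s] i)).
by rewrite W detform_dual ?mulr1 // wdimE size_map.
Qed.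
End Dual.
End PointwiseForms.

(** * Differential forms in a chart *)
Lemma sum8E (V : nmodType) (F : 'I_8 -> V) : \sum_(i < 8) F i =
  F (ix 1) + F (ix 2) + F (ix 3) + F (ix 4) +
  F (ix 5) + F (ix 6) + F (ix 7) + F (ix 8).
Proof.
rewrite !big_ord_recl big_ord0 addr0 !addrA.
by do ![congr (_ + _)]; congr F; apply/val_inj; rewrite /= inordK.
Qed.

Lemma ixE n k : (k.-1 < n.+1)%N -> nat_of_ord (@ix n k) = k.-1.
Proof. exact: inordK. Qed.

Lemma forall_ix8 (P : 'I_8 -> Prop) : P (ix 1) -> P (ix 2) -> P (ix 3) -> P (ix 4) ->
  P (ix 5) -> P (ix 6) -> P (ix 7) -> P (ix 8) -> forall i, P i.
Proof.
move=> p1 p2 p3 p4 p5 p6 p7 p8 i.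
have : i = ix (val i).+1 by apply/val_inj; rewrite /= ixE /= ?ltn_ord.
by case: i => -[|[|[|[|[|[|[|[|//]]]]]]]] ? ->.
Qed.

Section Pointwise.
Variables (R : realType) (n : nat) (M : Type) (A : atlas R n M).

Lemma dform_addE k (a b : dform A k) c p v : (a + b) c p v = a c p v + b c p v.
Proof. by []. Qed.

Lemma dform_oppE k (a : dform A k) c p v : (- a) c p v = - a c p v.
Proof. by []. Qed.

Lemma dform_mul2E k (a : dform A k) c p v : (a *+ 2) c p v = 2 * a c p v.
Proof. by rewrite mulr2n dform_addE; ring. Qed.

Lemma dform_sumE k I (r : seq I) (P : pred I) (F : I -> dform A k) c p v :
  (\sum_(i <- r | P i) F i) c p v = \sum_(i <- r | P i) F i c p v.
Proof. by elim/big_rec2: _ => // i y1 y2 _ <-. Qed.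

Lemma scalefE k f (a : dform A k) c p v : (f ⋅ a) c p v = f p * a c p v.
Proof. by []. Qed.

Lemma wedge11 (a b : dform A 1) c p (x y : 'rV[R]_n) :
  (a ∧ b) c p (col_mx x y) = a c p x * b c p y - a c p y * b c p x.
Proof. exact: pwedge11. Qed.

Definition dformE :=
  (dform_addE, dform_oppE, dform_mul2E, scalefE, wedge11).

Lemma lin1_dform (a : dform A 1) c p : is_dform a -> dom c p -> lin1 (a c p).
Proof.
case=> + _ _ => /[apply] -[aM _] k x y.
have E (z : 'rV[R]_n) : row 0 z = z by apply/rowP=> j; rewrite mxE.
rewrite (aM 0 k 1 _ x y) ?mul1r ?E ?scale1r //; apply/matrixP => -[] //.
Qed.

Lemma lin1_sum (t : pform R n 1) I (r : seq I) (F : I -> 'rV[R]_n) (b : I -> R) :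
  lin1 t -> t (\sum_(i <- r) b i *: F i) = \sum_(i <- r) b i * t (F i).
Proof.
move=> lt; have t0 : t 0 = 0.
  by have := lt (-1) 0 0; rewrite scaler0 addr0 mulN1r addNr.
by elim/big_rec2: _ => // i y1 y2 _ <-; rewrite lt.
Qed.

(** Inverting the matrix of the coframe gives tangent vectors with prescribed
    coordinates in it. *)
Lemma coframe_surj (w : 'I_n -> dform A 1) c p (r : 'I_n -> R) : coframe w -> dom c p ->
  exists z : 'rV[R]_n, forall i, w i c p z = r i.
Proof.
move=> [w1 w2] dp; have W := w2 c p dp; set B := \matrix_(_, _) _ in W.
exists (invmx B *m \col_i r i)^T => i; set z := _^T.
rewrite [z]row_sum_delta lin1_sum; last exact: lin1_dform.
have : (B *m z^T) i 0 = r i by rewrite trmxK mulKVmx // mxE.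
by move=> <-; rewrite mxE; apply: eq_bigr => j _; rewrite !mxE mulrC.
Qed.

End Pointwise.

(** * The reduced group *)
Section Group.
Variables (R : realType) (x : 'rV[R]_23).

Let act (o : 'I_8 -> R) (i : 'I_8) := \sum_(j < 8) G0_mx x i j * o j.

Lemma G0_actE o :
  [/\ act o (ix 1) = a29 x * a38 x * a49 x * b7 x ^+ 2 *
        ((1 + b5 x * b6 x) * o (ix 1) + b5 x * o (ix 2) + b6 x * o (ix 3)),
      act o (ix 2) = a38 x ^+ 2 * a49 x * b7 x ^+ 2 *
        (2 * b6 x * o (ix 1) + o (ix 2) + b6 x ^+ 2 * o (ix 3)),
      act o (ix 3) = a29 x ^+ 2 * a49 x * b7 x ^+ 2 *
        (2 * b5 x * o (ix 1) + b5 x ^+ 2 * o (ix 2) + o (ix 3)),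
      act o (ix 4) = a16 x * o (ix 1) + a17 x * o (ix 2) + a18 x * o (ix 3) +
        a29 x * a49 x * b7 x * (o (ix 4) + b5 x * o (ix 5))
    & [/\ act o (ix 5) = a21 x * o (ix 1) + a22 x * o (ix 2) + a23 x * o (ix 3) +
            a38 x * a49 x * b7 x * (b6 x * o (ix 4) + o (ix 5)),
          act o (ix 6) = a26 x * o (ix 1) + a27 x * o (ix 2) + a28 x * o (ix 3) +
            a29 x * (o (ix 4) + b5 x * o (ix 5) + b7 x * (o (ix 6) + b5 x * o (ix 7))),
          act o (ix 7) = a34 x * o (ix 1) + a35 x * o (ix 2) + a36 x * o (ix 3) +
            a38 x * (b6 x * o (ix 4) + o (ix 5) + b7 x * (b6 x * o (ix 6) + o (ix 7)))
        & act o (ix 8) = a42 x * o (ix 1) + a43 x * o (ix 2) + a44 x * o (ix 3) +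
            a45 x * o (ix 4) + a46 x * o (ix 5) + a49 x * o (ix 8) ]].
Proof.
by split; [..|split]; rewrite /act sum8E !mxE !ixE //=; ring.
Qed.

End Group.

(** * Common kernels of six rows of the group *)
Lemma mulf_sub_eq0 (R : idomainType) (a b k : R) : k != 0 -> k * (a - b) = 0 -> a = b.
Proof.
by move=> k0 /eqP; rewrite mulf_eq0 (negPf k0) subr_eq0 => /eqP.
Qed.

(** The common kernel of the rows 1, 2, 4, 5, 7 of the group, with o_i standing
    for omega^i.  The coefficients are free, so that the rows 1, 3, 5, 4, 6 are
    an instance, after the exchange of indices and parameters that is a
    symmetry of the group.  The numbers r4, r5, r7 do not depend on the vector:
    this is what makes omega^4, omega^5 proportional to omega^3 as forms. *)
Lemma kernel_param (R : fieldType)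
    (b5 b6 b7 h1 h2 g4 g5 g7 p1 p2 p3 q1 q2 q3 s1 s2 s3 : R) :
  1 - b5 * b6 != 0 -> b7 != 0 -> h1 != 0 -> h2 != 0 -> g4 != 0 -> g5 != 0 -> g7 != 0 ->
  exists r4 r5 r7, forall o1 o2 o3 o4 o5 o6 o7,
    h1 * ((1 + b5 * b6) * o1 + b5 * o2 + b6 * o3) = 0 ->
    h2 * (2 * b6 * o1 + o2 + b6 ^+ 2 * o3) = 0 ->
    p1 * o1 + p2 * o2 + p3 * o3 + g4 * (o4 + b5 * o5) = 0 ->
    q1 * o1 + q2 * o2 + q3 * o3 + g5 * (b6 * o4 + o5) = 0 ->
    s1 * o1 + s2 * o2 + s3 * o3 +
      g7 * (b6 * o4 + o5 + b7 * (b6 * o6 + o7)) = 0 ->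
    [/\ o1 = - b6 * o3, o2 = b6 ^+ 2 * o3, o4 = r4 * o3, o5 = r5 * o3
      & o7 = - b6 * o6 + r7 * o3].
Proof.
move=> D0 b70 h10 h20 g40 g50 g70.
pose c4 := - (- p1 * b6 + p2 * b6 ^+ 2 + p3) / g4.
pose c5 := - (- q1 * b6 + q2 * b6 ^+ 2 + q3) / g5.
pose c7 := - (- s1 * b6 + s2 * b6 ^+ 2 + s3) / g7.
exists ((c4 - b5 * c5) / (1 - b5 * b6)), ((c5 - b6 * c4) / (1 - b5 * b6)), ((c7 - c5) / b7).
move=> o1 o2 o3 o4 o5 o6 o7 /eqP; rewrite mulf_eq0 (negPf h10) /= => /eqP E1.
move=> /eqP; rewrite mulf_eq0 (negPf h20) /= => /eqP E2 E4 E5 E7.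
have e1 : o1 = - b6 * o3.
  (* Row 1 minus b5 times row 2. *)
  apply: (mulf_sub_eq0 D0).
  by rewrite -[RHS](subrr (0 : R)) -{1}E1 -[in RHS](mulr0 b5) -E2; ring.
have e2 : o2 = b6 ^+ 2 * o3.
  by apply/eqP; rewrite -subr_eq0 -E2 e1; apply/eqP; ring.
have e4 : o4 + b5 * o5 = c4 * o3.
  by apply: (mulf_sub_eq0 g40); rewrite -E4 e1 e2 /c4; field.
have e5 : b6 * o4 + o5 = c5 * o3.
  by apply: (mulf_sub_eq0 g50); rewrite -E5 e1 e2 /c5; field.
have e7 : b6 * o4 + o5 + b7 * (b6 * o6 + o7) = c7 * o3.
  by apply: (mulf_sub_eq0 g70); rewrite -E7 e1 e2 /c7; field.
split=> //.
- transitivity ((c4 * o3 - b5 * (c5 * o3)) / (1 - b5 * b6)); last by ring.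
  by rewrite -e4 -e5; field.
- transitivity ((c5 * o3 - b6 * (c4 * o3)) / (1 - b5 * b6)); last by ring.
  by rewrite -e4 -e5; field.
- transitivity (- b6 * o6 + (c7 * o3 - c5 * o3) / b7); last by ring.
  by rewrite -e7 -e5; field.
Qed.

Section GroupKernels.
Variables (R : realType) (x : 'rV[R]_23).
Hypothesis xG : G0 x.
Local Notation act o i := (\sum_(j < 8) G0_mx x i j * o j).

Lemma G0_neq0 : [/\ a29 x != 0, a38 x != 0, a49 x != 0, b7 x != 0 & 1 - b5 x * b6 x != 0].
Proof.
move: xG; rewrite /G0 /= !mulf_eq0 !negb_or.
by do 4![case/andP]; move=> -> -> -> -> ->.
Qed.

Lemma G0_kernel2 : exists r4 r5 r7, forall o : 'I_8 -> R,
  {in [:: ix 1; ix 2; ix 4; ix 5; ix 7; ix 8], forall i, act o i = 0} ->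
  [/\ o (ix 1) = - b6 x * o (ix 3), o (ix 2) = b6 x ^+ 2 * o (ix 3),
      o (ix 4) = r4 * o (ix 3), o (ix 5) = r5 * o (ix 3)
    & o (ix 7) = - b6 x * o (ix 6) + r7 * o (ix 3)].
Proof.
have [a0 a0' a0'' b0 D0] := G0_neq0.
have [||||||r4 [r5 [r7 K]]] := @kernel_param _ (b5 x) (b6 x) (b7 x)
  (a29 x * a38 x * a49 x * b7 x ^+ 2) (a38 x ^+ 2 * a49 x * b7 x ^+ 2)
  (a29 x * a49 x * b7 x) (a38 x * a49 x * b7 x) (a38 x)
  (a16 x) (a17 x) (a18 x) (a21 x) (a22 x) (a23 x) (a34 x) (a35 x) (a36 x) D0;
  rewrite ?mulf_neq0 ?expf_neq0 //.
exists r4, r5, r7 => o o0.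
have [E1 E2 _ E4 [E5 _ E7 _]] := G0_actE x o.
by apply: K; rewrite -?E1 -?E2 -?E4 -?E5 -?E7; apply: o0; rewrite !inE eqxx ?orbT.
Qed.

Lemma G0_kernel3 : exists r4 r5 r6, forall o : 'I_8 -> R,
  {in [:: ix 1; ix 3; ix 4; ix 5; ix 6; ix 8], forall i, act o i = 0} ->
  [/\ o (ix 1) = - b5 x * o (ix 2), o (ix 3) = b5 x ^+ 2 * o (ix 2),
      o (ix 4) = r4 * o (ix 2), o (ix 5) = r5 * o (ix 2)
    & o (ix 6) = - b5 x * o (ix 7) + r6 * o (ix 2)].
Proof.
have [a0 a0' a0'' b0 D0] := G0_neq0.
have D0' : 1 - b6 x * b5 x != 0 by rewrite mulrC.
(* The exchange of 2 and 3, 4 and 5, 6 and 7 permutes the entries of the rows. *)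
have [||||||r5 [r4 [r6 K]]] := @kernel_param _ (b6 x) (b5 x) (b7 x)
  (a29 x * a38 x * a49 x * b7 x ^+ 2) (a29 x ^+ 2 * a49 x * b7 x ^+ 2)
  (a38 x * a49 x * b7 x) (a29 x * a49 x * b7 x) (a29 x)
  (a21 x) (a23 x) (a22 x) (a16 x) (a18 x) (a17 x) (a26 x) (a28 x) (a27 x) D0';
  rewrite ?mulf_neq0 ?expf_neq0 //.
exists r4, r5, r6 => o o0.
have [E1 _ E3 E4 [E5 E6 _ _]] := G0_actE x o.
have Z i : i \in [:: ix 1; ix 3; ix 4; ix 5; ix 6; ix 8] -> act o i = 0 by apply: o0.
have [] := K (o (ix 1)) (o (ix 3)) (o (ix 2)) (o (ix 5)) (o (ix 4)) (o (ix 7)) (o (ix 6)).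
- by rewrite -[RHS](Z (ix 1)) ?inE ?eqxx ?orbT // E1; ring.
- by rewrite -[RHS](Z (ix 3)) ?inE ?eqxx ?orbT // E3; ring.
- by rewrite -[RHS](Z (ix 5)) ?inE ?eqxx ?orbT // E5; ring.
- by rewrite -[RHS](Z (ix 4)) ?inE ?eqxx ?orbT // E4; ring.
- by rewrite -[RHS](Z (ix 6)) ?inE ?eqxx ?orbT // E6; ring.
by move=> e1 e3 e5 e4 e6; split.
Qed.

(** A vector in the kernel lies in the space of [G0_kernel2]; its third, sixth and
    eighth coordinates then vanish by the rows 3, 6 and 8. *)
Lemma G0_unit : G0_mx x \in unitmx.
Proof.
rewrite -unitmx_tr -row_free_unit; apply: inj_row_free => v v0.
have Z i : act (v 0) i = 0.
  transitivity ((v *m (G0_mx x)^T) 0 i); last by rewrite v0 mxE.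
  by rewrite mxE; apply: eq_bigr => j _; rewrite [_^T _ _]mxE mulrC.
have [a0 a0' a0'' b0 D0] := G0_neq0.
have [r4 [r5 [r7 K]]] := G0_kernel2.
have [e1 e2 e4 e5 e7] := K (v 0) (fun i _ => Z i).
have [_ _ E3 _ [_ E6 _ E8]] := G0_actE x (v 0); move: E3 E6 E8; rewrite !Z.
have -> : 2 * b5 x * v 0 (ix 1) + b5 x ^+ 2 * v 0 (ix 2) + v 0 (ix 3) =
  (1 - b5 x * b6 x) ^+ 2 * v 0 (ix 3) by rewrite e1 e2; ring.
move=> /esym/eqP; rewrite !mulf_eq0 ?expf_eq0 /=.
rewrite (negPf a0) (negPf a0'') (negPf b0) (negPf D0) /=.
move=> /eqP e3; move: e1 e2 e4 e5 e7; rewrite !e3 !mulr0 addr0 => e1 e2 e4 e5 e7.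
rewrite e1 e2 e4 e5 e7 !mulr0 !add0r => /esym/eqP.
have -> : v 0 (ix 6) + b5 x * (- b6 x * v 0 (ix 6)) =
  (1 - b5 x * b6 x) * v 0 (ix 6) by ring.
rewrite !mulf_eq0 (negPf a0) (negPf b0) (negPf D0) /= => /eqP e6 /esym/eqP.
rewrite mulf_eq0 (negPf a0'') => /eqP e8.
apply/rowP; apply: forall_ix8; rewrite ?mxE //.
by rewrite e7 e6 mulr0.
Qed.
End GroupKernels.

(** * Exterior derivative of the lifted coframe *)
Section Derivatives.
Variable R : realType.

Lemma is_derive_comp_linear (V W : normedModType R) (l : V -> W) (f : W -> R^o) y v df :
  (forall h, l (h *: v + y) = h *: l v + l y) ->
  is_derive (l y) (l v) f df -> is_derive y v (fun z => f (l z)) df.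
Proof.
move=> ll [f1 f2].
have E : (fun h => h^-1 *: ((fun z => f (l z)) (h *: v + y) - f (l y))) =
         (fun h => h^-1 *: (f (h *: l v + l y) - f (l y))).
  by apply/funext => h; rewrite ll.
split; first by move: f1; rewrite /derivable /= -E.
by rewrite -f2 /derive /= -E.
Qed.

(** Linearity of the derivative is included since it has to be a covector. *)
Definition diff_at m (f : 'rV[R]_m -> R) (x : 'rV[R]_m) (d : 'rV[R]_m -> R) :=
  (forall v, is_derive x v (f : _ -> R^o) (d v)) /\ lin1 d.

Lemma diff_at_coord m (x : 'rV[R]_m) k : diff_at (fun y => y 0 k) x (fun v => v 0 k).
Proof.
split=> [v|c y z]; last by rewrite !mxE.
have E : (fun h : R => h^-1 *: ((h *: v + x) 0 k - x 0 k : R^o)) =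
    fun h => h^-1 * (h * v 0 k).
  by apply/funext => h; rewrite !mxE addrK.
have C : (fun h : R => h^-1 *: ((h *: v + x) 0 k - x 0 k : R^o)) @ 0^' --> (v 0 k : R^o).
  rewrite E; apply: cvg_near_cst; near=> h.
  rewrite mulKf //; near: h; exact: nbhs_dnbhs_neq.
by split; [apply/cvg_ex; exists (v 0 k) | apply/cvg_lim].
Unshelve. all: by end_near. Qed.

Lemma diff_at_cst m (x : 'rV[R]_m) a : diff_at (fun=> a) x (fun=> 0).
Proof. by split=> [v|c y z]; [exact: is_derive_cst | rewrite mulr0 addr0]. Qed.

Lemma diff_atM m f g (x : 'rV[R]_m) df dg : diff_at f x df -> diff_at g x dg ->
  diff_at (fun y => f y * g y) x (fun v => f x * dg v + g x * df v).
Proof.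
move=> [f1 f2] [g1 g2]; split=> [v|c y z]; first exact: is_deriveM.
by rewrite f2 g2; ring.
Qed.

(** (2 b, 1, b^2) runs over a conic, and its pairing with (- b0, b0^2, 1) is
    (b - b0)^2.  The double zero at b0 = b x makes the pairing with the derivative
    of h (2 b, 1, b^2) vanish at x. *)
Lemma diff_at_quadric m (h b : 'rV[R]_m -> R) x dh db :
  diff_at h x dh -> diff_at b x db ->
  exists dP dQ, [/\ diff_at (fun y => h y * (2 * b y)) x dP,
    diff_at (fun y => h y * (b y * b y)) x dQ &
    forall v, dQ v = b x * dP v - b x ^+ 2 * dh v].
Proof.
move=> hP bP; have cP := diff_at_cst x (2 : R).
do 2!eexists; split.
- exact: diff_atM hP (diff_atM cP bP).
- exact: diff_atM hP (diff_atM bP bP).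
- by move=> v /=; ring.
Qed.

Lemma diff_at_quadric_scale (a a' b : 'I_23) x : exists d,
  diff_at (fun y : 'rV[R]_23 => y 0 a * y 0 a * y 0 a' * (y 0 b * y 0 b)) x d.
Proof.
have [[ca ca'] cb] := (diff_at_coord x a, diff_at_coord x a', diff_at_coord x b).
by eexists; exact: diff_atM (diff_atM (diff_atM ca ca) ca') (diff_atM cb cb).
Qed.

Lemma diff_at_G0_row2 x : exists dg : 'I_8 -> 'rV[R]_23 -> R,
  [/\ forall j, diff_at (fun y => G0_mx y (ix 2) j) x (dg j),
      forall (j : 'I_8) v, (3 <= j)%N -> dg j v = 0 &
      forall v, dg (ix 3) v = b6 x * dg (ix 1) v - b6 x ^+ 2 * dg (ix 2) v].
Proof.
have [dh hP] := diff_at_quadric_scale (ix 14) (ix 20) (ix 23) x.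
have [dP [dQ [PP QP PQ]]] := diff_at_quadric hP (diff_at_coord x (ix 22)).
exists (fun j => nth (fun=> 0) [:: dP; dh; dQ] j); split=> [|j v j3|v].
- apply: forall_ix8; rewrite ixE //=; set f := (X in diff_at X);
    [move: PP|move: hP|move: QP|..];
    try (by move: (diff_at_cst x (0 : R)); congr (diff_at _ _ _); apply/funext => y;
           rewrite /f mxE !ixE);
    by congr (diff_at _ _ _); apply/funext => y; rewrite /f mxE !ixE //=
         /a38 /a49 /b6 /b7; ring.
- by rewrite nth_default.
- by rewrite !ixE //= PQ.
Qed.

Lemma diff_at_G0_row3 x : exists dg : 'I_8 -> 'rV[R]_23 -> R,
  [/\ forall j, diff_at (fun y => G0_mx y (ix 3) j) x (dg j),
      forall (j : 'I_8) v, (3 <= j)%N -> dg j v = 0 &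
      forall v, dg (ix 2) v = b5 x * dg (ix 1) v - b5 x ^+ 2 * dg (ix 3) v].
Proof.
have [dh hP] := diff_at_quadric_scale (ix 10) (ix 20) (ix 23) x.
have [dP [dQ [PP QP PQ]]] := diff_at_quadric hP (diff_at_coord x (ix 21)).
exists (fun j => nth (fun=> 0) [:: dP; dQ; dh] j); split=> [|j v j3|v].
- apply: forall_ix8; rewrite ixE //=; set f := (X in diff_at X);
    [move: PP|move: QP|move: hP|..];
    try (by move: (diff_at_cst x (0 : R)); congr (diff_at _ _ _); apply/funext => y;
           rewrite /f mxE !ixE);
    by congr (diff_at _ _ _); apply/funext => y; rewrite /f mxE !ixE //=
         /a29 /a49 /b5 /b7; ring.
- by rewrite nth_default.
- by rewrite !ixE //= PQ.
Qed.

End Derivatives.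

Lemma extd1E (R : realType) n M (A : atlas R n M) (a : dform A 1) c p (X Y : 'rV[R]_n) :
  extd a c p (col_mx X Y) =
    'D_X ((fun y => a c (fromR c y) Y) : 'rV[R]_n -> R^o) (toR c p) -
    'D_Y ((fun y => a c (fromR c y) X) : 'rV[R]_n -> R^o) (toR c p).
Proof.
rewrite /extd !big_ord_recl big_ord0 /= addr0.
have E0 : row' ord0 (col_mx X Y) = Y.
  apply/rowP=> k; rewrite mxE -[RHS](col_mxEd X Y).
  by congr (col_mx X Y _ _); apply/val_inj.
have E1 : row' (lift ord0 ord0) (col_mx X Y) = X.
  apply/rowP=> k; rewrite mxE -[RHS](col_mxEu X Y).
  by congr (col_mx X Y _ _); apply/val_inj.
have F1 : row (lift ord0 ord0) (col_mx X Y) = Y.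
  by rewrite -[RHS](row1_col_mx X Y); congr (row _ _); apply/val_inj.
have F0 : row ord0 (col_mx X Y) = X by rewrite row0_col_mx.
by rewrite E0 E1 F0 F1 expr0 mul1r expr1 mulN1r.
Qed.

Section Extd.
Variables (R : realType) (M : topologicalType) (A : atlas R 8 M).
Variables (w : 'I_8 -> dform A 1).
Hypothesis Am : smooth_manifold A.
Hypothesis wd : forall i, is_dform (w i).

Lemma smooth_derivable (a : dform A 1) c p v : is_dform a -> dom c p ->
  forall z, derivable ((fun y => a c (fromR c y) v) : 'rV[R]_8 -> R^o) (toR c p) z.
Proof.
case=> _ _ /(_ c v 1%N) [da _] dp z; apply: da; by exists p.
Qed.

(** d(g omega) = dg ∧ omega + g d omega, where g depends only on the point of the
    group and omega only on the point of the manifold. *)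
Lemma extd_lifted i (dg : 'I_8 -> 'rV[R]_23 -> R) (c : chart A) (p : M) x
    (X Y : 'rV[R]_(8 + 23)) :
  dom c p -> (forall j, diff_at (fun y => G0_mx y i j) x (dg j)) ->
  extd (lifted_coframe w i) c (p, x) (col_mx X Y) =
  \sum_(j < 8) (dg j (rsubmx X) * w j c p (lsubmx Y)
              - dg j (rsubmx Y) * w j c p (lsubmx X)
              + G0_mx x i j * extd (w j) c p (col_mx (lsubmx X) (lsubmx Y))).
Proof.
move=> dp dgP.
(* Product rule along the constant vector field X1. *)
have D (X1 Y1 : 'rV[R]_(8 + 23)) : 'D_X1 ((fun y : 'rV[R]_(8 + 23) =>
     lifted_coframe w i c (fromR c (lsubmx y), rsubmx y) Y1) : _ -> R^o)
     (row_mx (toR c p) x) = \sum_(j < 8) (dg j (rsubmx X1) * w j c p (lsubmx Y1) +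
      G0_mx x i j * 'D_(lsubmx X1) ((fun y => w j c (fromR c y) (lsubmx Y1)) : _ -> R^o)
         (toR c p)).
  set y0 := row_mx _ _.
  have -> : (fun y : 'rV[R]_(8 + 23) =>
     lifted_coframe w i c (fromR c (lsubmx y), rsubmx y) Y1) = \sum_(j < 8)
      ((fun y => G0_mx (rsubmx y) i j) *
       (fun y => w j c (fromR c (lsubmx y)) (lsubmx Y1))).
    apply/funext => y; rewrite fct_sumE /lifted_coframe dform_sumE.
    by apply: eq_bigr => j _.
  apply: derive_val; apply: is_derive_sum => j.
  have [G _] := dgP j.
  have := @smooth_derivable (w j) c p (lsubmx Y1) (wd j) dp (lsubmx X1).
  set H := fun y => w j c (fromR c y) _.
  move=> /derivableP dH.
  have y0r : rsubmx y0 = x by rewrite row_mxKr.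
  have y0l : lsubmx y0 = toR c p by rewrite row_mxKl.
  apply: is_derive_eq.
    apply: is_deriveM.
      apply: (is_derive_comp_linear (l := rsubmx) (f := fun y => G0_mx y i j)).
        by move=> h; rewrite linearP.
      by rewrite y0r; exact: G.
    apply: (is_derive_comp_linear (l := lsubmx) (f := H)).
      by move=> h; rewrite linearP.
    by rewrite y0l; exact: dH.
  rewrite /= y0r y0l /H (chart_cancel Am) ?inE // addrC.
  by congr (_ + _); rewrite mulrC.
rewrite !extd1E /= !D -sumrB; apply: eq_bigr => j _.
by rewrite extd1E; ring.
Qed.
End Extd.

(** * The error forms on the common kernels *)
Section Alt2.
Variables (R : realType) (n : nat) (M : Type) (A : atlas R n M).
Variables (c : chart A) (p : M).
Implicit Types a b : dform A 2.

Lemma alt2_dform0 : alt2 ((0 : dform A 2) c p).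
Proof. by split=> *; rewrite ?mulr0 ?addr0 ?oppr0. Qed.

Lemma alt2_dformD a b : alt2 (a c p) -> alt2 (b c p) -> alt2 ((a + b) c p).
Proof.
move=> [a1 a2] [b1 b2]; split=> [k x y z|x y]; rewrite !dform_addE.
  by rewrite a1 b1; ring.
by rewrite a2 b2; ring.
Qed.

Lemma alt2_dformN a : alt2 (a c p) -> alt2 ((- a) c p).
Proof.
move=> [a1 a2]; split=> [k x y z|x y]; rewrite !dform_oppE; first by rewrite a1; ring.
by rewrite a2.
Qed.

Lemma alt2_dform_mul2 a : alt2 (a c p) -> alt2 ((a *+ 2) c p).
Proof. by rewrite mulr2n => aa; apply: alt2_dformD. Qed.

Lemma alt2_scalef f a : alt2 (a c p) -> alt2 ((f ⋅ a) c p).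
Proof.
move=> [a1 a2]; split=> [k x y z|x y]; rewrite !scalefE; first by rewrite a1; ring.
by rewrite a2; ring.
Qed.

Lemma alt2_dform_sum I (r : seq I) (P : pred I) (F : I -> dform A 2) :
  (forall i, alt2 (F i c p)) -> alt2 ((\sum_(i <- r | P i) F i) c p).
Proof.
move=> aF; elim/big_rec: _ => [|i y _ ay]; first exact: alt2_dform0.
exact: alt2_dformD.
Qed.

Lemma alt2_wedge (a b : dform A 1) : lin1 (a c p) -> lin1 (b c p) -> alt2 ((a ∧ b) c p).
Proof. exact: alt2_pwedge. Qed.

Lemma eq_alt2 a b : a =f b -> dom c p -> alt2 (b c p) -> alt2 (a c p).
Proof. by move=> ab dp; suff -> : a c p = b c p by []; apply/funext=> v; exact: ab. Qed.

End Alt2.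

Section Main.
Variables (R : realType) (M : topologicalType) (A : atlas R 8 M).
Variables (w : 'I_8 -> dform A 1) (u : 'I_12 -> M -> R).
Hypothesis Am : smooth_manifold A.
Hypothesis wc : coframe w.
Hypothesis wS : structure_equations u w.
Variables (c : chart A) (p : M) (x : 'rV[R]_23).
Hypotheses (dp : dom c p) (xG : G0 x).

Local Notation V := ('rV[R]_(8 + 23)).
Local Notation th i := (lifted_coframe w i (c : chart (atlasG0 A)) (p, x)).
Local Notation om j X := (w j c p (lsubmx X)).

Lemma lin1_coframe j : lin1 (w j c p).
Proof. by apply: lin1_dform => //; case: wc. Qed.

(** The structure equations exhibit each d omega^j as a combination of wedge
    products of covectors. *)
Lemma alt2_extd_coframe j : alt2 (extd (w j) c p).
Proof.
move: j; case: wS => e1 e2 e3 [e4 e5] [e6 e7 e8].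
have W := lin1_coframe.
apply: forall_ix8; [apply: (eq_alt2 e1)|apply: (eq_alt2 e2)|apply: (eq_alt2 e3)|
  apply: (eq_alt2 e4)|apply: (eq_alt2 e5)|apply: (eq_alt2 e6)|apply: (eq_alt2 e7)|
  apply: (eq_alt2 e8)] => //; try exact: alt2_dform0;
  repeat first [apply: alt2_dformD | apply: alt2_dformN | apply: alt2_dform_mul2
    | apply: alt2_scalef | by apply: alt2_wedge].
Qed.

Lemma lifted_coframeE i X : th i X = \sum_(j < 8) G0_mx x i j * om j X.
Proof. by rewrite /lifted_coframe dform_sumE. Qed.

Lemma lin1_lifted_coframe i : lin1 (th i).
Proof.
move=> k X Y; rewrite !lifted_coframeE mulr_sumr -big_split /=.
by apply: eq_bigr => j _; rewrite linearP lin1_coframe; ring.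
Qed.

Lemma lifted_coframe_dual : exists e : 'I_8 -> V, forall i j, th i (e j) = (i == j)%:R.
Proof.
suff S j : exists X : V, forall i, th i X = (i == j)%:R.
  by have [e E] := choice S; exists e => i j; exact: E.
pose o := invmx (G0_mx x) *m delta_mx j 0 : 'cV[R]_8.
have [z zE] := coframe_surj (fun i => o i 0) wc dp.
exists (row_mx z 0) => i; rewrite lifted_coframeE.
transitivity ((G0_mx x *m o) i 0).
  by rewrite mxE; apply: eq_bigr => k _; rewrite row_mxKl zE.
by rewrite mulKVmx ?G0_unit // !mxE eqxx andbT.
Qed.

Lemma alt2_extd_lifted i dg :
  (forall j, diff_at (fun y => G0_mx y i j) x (dg j)) ->
  alt2 (extd (lifted_coframe w i) (c : chart (atlasG0 A)) (p, x)).
Proof.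
move=> dgP; have wd : forall i, is_dform (w i) by case: wc.
have E := extd_lifted Am wd _ _ dp dgP.
split=> [k X Y Z|X Y]; rewrite !E.
  rewrite mulr_sumr -big_split; apply: eq_bigr => j _ /=.
  have [[[_ dl] [el _]] wl] := (dgP j, alt2_extd_coframe j, lin1_coframe j).
  by rewrite !linearP /= dl el wl; ring.
rewrite -sumrN; apply: eq_bigr => j _ /=; have [_ ->] := alt2_extd_coframe j; ring.
Qed.

Section TorsionPart.
Variables (t : 'I_8 -> 'I_8 -> M * 'rV[R]_23 -> R).

Lemma alt2_torsion : alt2 (torsion (lifted_coframe w) t (c : chart (atlasG0 A)) (p, x)).
Proof.
rewrite /torsion; do 2!(apply: alt2_dform_sum => ?).
by apply/alt2_scalef/alt2_wedge; exact: lin1_lifted_coframe.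
Qed.

(** In a term i < j with i < 3 that survives, i can only be a, as b is at least 3,
    and then j can only be b. *)
Lemma torsion_kernel (a b : 'I_8) (X Y : V) : (a < 3 <= b)%N ->
  (forall i, i != a -> i != b -> th i X = 0) ->
  (forall i, i != a -> i != b -> th i Y = 0) ->
  torsion (lifted_coframe w) t (c : chart (atlasG0 A)) (p, x) (col_mx X Y) =
    t a b (p, x) * (th a X * th b Y - th a Y * th b X).
Proof.
case/andP=> a3 b3 X0 Y0; rewrite /torsion dform_sumE (bigD1 a) //= dform_sumE.
rewrite (bigD1 b) ?(leq_trans a3) //= scalefE wedge11.
rewrite big1 => [|j /andP[aj jb]]; last first.
  have ja : j != a by apply: contraTneq aj => ->; rewrite ltnn.
  by rewrite scalefE wedge11 (X0 j) // (Y0 j) //; ring.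
rewrite big1 ?addr0 // => i /andP[i3 ia]; rewrite dform_sumE big1 // => j _.
rewrite scalefE wedge11 (X0 i) ?(Y0 i) //; first by ring.
by apply: contraTneq i3 => ->; rewrite -leqNgt.
by apply: contraTneq i3 => ->; rewrite -leqNgt.
Qed.

End TorsionPart.

Section Coefficients.
Variables (Om : 'I_4 -> dform (atlasG0 A) 1).
Variables (t : 'I_8 -> 'I_8 -> M * 'rV[R]_23 -> R).
Hypothesis Omd : forall k, is_dform (Om k).
Local Notation q := (p, x).
Local Notation c' := (c : chart (atlasG0 A)).

Lemma lin1_Om k : lin1 (Om k c' q).
Proof.
exact: (lin1_dform (A := atlasG0 A) (c := c) (p := (p, x)) (Omd k) (conj dp xG)).
Qed.

Lemma alt2_E2 : alt2 (E2 (lifted_coframe w) Om t c' q).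
Proof.
have [dg [dgP _ _]] := diff_at_G0_row2 x.
have [W O] := (lin1_lifted_coframe, lin1_Om).
apply: alt2_dformD; first exact: alt2_extd_lifted dgP.
by apply: alt2_dformN; repeat first [apply: alt2_torsion | apply: alt2_dformD |
  apply: alt2_dformN | apply: alt2_dform_mul2 | by apply: alt2_wedge].
Qed.

Lemma alt2_E3 : alt2 (E3 (lifted_coframe w) Om t c' q).
Proof.
have [dg [dgP _ _]] := diff_at_G0_row3 x.
have [W O] := (lin1_lifted_coframe, lin1_Om).
apply: alt2_dformD; first exact: alt2_extd_lifted dgP.
by apply: alt2_dformN; repeat first [apply: alt2_torsion | apply: alt2_dformD |
  apply: alt2_dformN | apply: alt2_dform_mul2 | by apply: alt2_wedge].
Qed.

Lemma ix_eqE k l : (0 < k <= 8)%N -> (0 < l <= 8)%N -> (@ix 7 k == ix l) = (k == l).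
Proof. by case: k l => [|k] [|l] //= k8 l8; rewrite -val_eqE /= !ixE. Qed.

Lemma lifted_kernel2 : exists r4 r5 r7, forall X : V,
  {in [:: ix 1; ix 2; ix 4; ix 5; ix 7; ix 8], forall i, th i X = 0} ->
  [/\ om (ix 1) X = - b6 x * om (ix 3) X, om (ix 2) X = b6 x ^+ 2 * om (ix 3) X,
      om (ix 4) X = r4 * om (ix 3) X, om (ix 5) X = r5 * om (ix 3) X
    & om (ix 7) X = - b6 x * om (ix 6) X + r7 * om (ix 3) X].
Proof.
have [r4 [r5 [r7 K]]] := G0_kernel2 xG; exists r4, r5, r7 => X X0.
by apply: (K (fun j => om j X)) => i /X0; rewrite lifted_coframeE.
Qed.

Lemma lifted_wedge_kernel2 (X Y : V) :
  {in [:: ix 1; ix 2; ix 4; ix 5; ix 7; ix 8], forall i, th i X = 0} ->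
  {in [:: ix 1; ix 2; ix 4; ix 5; ix 7; ix 8], forall i, th i Y = 0} ->
  th (ix 3) X * th (ix 6) Y - th (ix 3) Y * th (ix 6) X =
  a29 x ^+ 3 * a49 x * b7 x ^+ 3 * (1 - b5 x * b6 x) ^+ 3 *
    (om (ix 3) X * om (ix 6) Y - om (ix 3) Y * om (ix 6) X).
Proof.
move=> X0 Y0; have [r4 [r5 [r7 K]]] := lifted_kernel2.
have [X1 X2 X4 X5 X7] := K _ X0; have [Y1 Y2 Y4 Y5 Y7] := K _ Y0.
rewrite !lifted_coframeE.
have [_ _ -> _ [_ -> _ _]] := G0_actE x (fun j => om j X).
have [_ _ -> _ [_ -> _ _]] := G0_actE x (fun j => om j Y).
rewrite X1 X2 X4 X5 X7 Y1 Y2 Y4 Y5 Y7; ring.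
Qed.

(** The derivatives of the group parameters cancel by [diff_at_quadric]; the
    numbers r4, r5, r7 cancel too, as omega^3 ∧ omega^3 = 0 and since the
    contributions to omega^4 ∧ omega^6 add up to 0, as do those to
    omega^5 ∧ omega^6. *)
Lemma extd_kernel2 (X Y : V) :
  {in [:: ix 1; ix 2; ix 4; ix 5; ix 7; ix 8], forall i, th i X = 0} ->
  {in [:: ix 1; ix 2; ix 4; ix 5; ix 7; ix 8], forall i, th i Y = 0} ->
  extd (lifted_coframe w (ix 2)) c' q (col_mx X Y) =
  - (a38 x ^+ 2 * a49 x * b7 x ^+ 2) * quintic (fun k => u k p) (b6 x) *
    (om (ix 3) X * om (ix 6) Y - om (ix 3) Y * om (ix 6) X).
Proof.
move=> X0 Y0; have [r4 [r5 [r7 K]]] := lifted_kernel2.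
have [X1 X2 X4 X5 X7] := K _ X0; have [Y1 Y2 Y4 Y5 Y7] := K _ Y0.
have [dg [dgP dg0 dg3]] := diff_at_G0_row2 x.
have wd : forall i, is_dform (w i) by case: wc.
rewrite (extd_lifted Am wd _ _ dp dgP) sum8E.
rewrite !(dg0 (ix 4)) ?(dg0 (ix 5)) ?(dg0 (ix 6)) ?(dg0 (ix 7)) ?(dg0 (ix 8)) ?ixE //.
rewrite !dg3.
case: wS => e1 e2 e3 _ _; rewrite e1 // e2 // e3 // !dformE /=.
rewrite ![G0_mx _ _ _]mxE !ixE //= X1 X2 X4 X5 X7 Y1 Y2 Y4 Y5 Y7 /quintic.
ring.
Qed.

(** Only d theta^2 and the torsion term t_36 survive on the kernel, and they are
    compared through their multiples of omega^3 ∧ omega^6. *)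
Lemma E2_kernel (X Y : V) :
  {in [:: ix 1; ix 2; ix 4; ix 5; ix 7; ix 8], forall i, th i X = 0} ->
  {in [:: ix 1; ix 2; ix 4; ix 5; ix 7; ix 8], forall i, th i Y = 0} ->
  E2 (lifted_coframe w) Om t c' q (col_mx X Y) =
   (a38 x ^+ 2 * quintic (fun k => u k p) (b6 x)
    / (a29 x ^+ 3 * b7 x * (b5 x * b6 x - 1) ^+ 3) - t (ix 3) (ix 6) q) *
   (th (ix 3) X * th (ix 6) Y - th (ix 3) Y * th (ix 6) X).
Proof.
move=> X0 Y0; have [a0 a0' a0'' b0 D0] := G0_neq0 xG.
have D0' : b5 x * b6 x - 1 != 0 by rewrite -opprB oppr_eq0.
have S Z : {in [:: ix 1; ix 2; ix 4; ix 5; ix 7; ix 8], forall i, th i Z = 0} ->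
    forall i, i != ix 3 -> i != ix 6 -> th i Z = 0.
  move=> Z0; apply: forall_ix8; rewrite ?eqxx // => _ _; apply: Z0;
    by rewrite !inE eqxx ?orbT.
rewrite /E2 !dformE (@torsion_kernel t (ix 3) (ix 6)) ?ixE //; [|exact: S|exact: S].
rewrite (S X X0 (ix 1)) ?(S Y Y0 (ix 1)) ?(S X X0 (ix 2)) ?(S Y Y0 (ix 2))
  ?(S X X0 (ix 5)) ?(S Y Y0 (ix 5)) ?(S X X0 (ix 7)) ?(S Y Y0 (ix 7)) ?ix_eqE //.
rewrite extd_kernel2 // lifted_wedge_kernel2 //; field.
by rewrite ?a0 ?a0' ?b0 ?D0'.
Qed.

Lemma lifted_kernel3 : exists r4 r5 r7, forall X : V,
  {in [:: ix 1; ix 3; ix 4; ix 5; ix 6; ix 8], forall i, th i X = 0} ->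
  [/\ om (ix 1) X = - b5 x * om (ix 2) X, om (ix 3) X = b5 x ^+ 2 * om (ix 2) X,
      om (ix 4) X = r4 * om (ix 2) X, om (ix 5) X = r5 * om (ix 2) X
    & om (ix 6) X = - b5 x * om (ix 7) X + r7 * om (ix 2) X].
Proof.
have [r4 [r5 [r7 K]]] := G0_kernel3 xG; exists r4, r5, r7 => X X0.
by apply: (K (fun j => om j X)) => i /X0; rewrite lifted_coframeE.
Qed.

Lemma lifted_wedge_kernel3 (X Y : V) :
  {in [:: ix 1; ix 3; ix 4; ix 5; ix 6; ix 8], forall i, th i X = 0} ->
  {in [:: ix 1; ix 3; ix 4; ix 5; ix 6; ix 8], forall i, th i Y = 0} ->
  th (ix 2) X * th (ix 7) Y - th (ix 2) Y * th (ix 7) X =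
  a38 x ^+ 3 * a49 x * b7 x ^+ 3 * (1 - b5 x * b6 x) ^+ 3 *
    (om (ix 2) X * om (ix 7) Y - om (ix 2) Y * om (ix 7) X).
Proof.
move=> X0 Y0; have [r4 [r5 [r7 K]]] := lifted_kernel3.
have [X1 X2 X4 X5 X7] := K _ X0; have [Y1 Y2 Y4 Y5 Y7] := K _ Y0.
rewrite !lifted_coframeE.
have [_ -> _ _ [_ _ -> _]] := G0_actE x (fun j => om j X).
have [_ -> _ _ [_ _ -> _]] := G0_actE x (fun j => om j Y).
rewrite X1 X2 X4 X5 X7 Y1 Y2 Y4 Y5 Y7; ring.
Qed.

Lemma extd_kernel3 (X Y : V) :
  {in [:: ix 1; ix 3; ix 4; ix 5; ix 6; ix 8], forall i, th i X = 0} ->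
  {in [:: ix 1; ix 3; ix 4; ix 5; ix 6; ix 8], forall i, th i Y = 0} ->
  extd (lifted_coframe w (ix 3)) c' q (col_mx X Y) =
  - (a29 x ^+ 2 * a49 x * b7 x ^+ 2) * quintic_dual (fun k => u k p) (b5 x) *
    (om (ix 2) X * om (ix 7) Y - om (ix 2) Y * om (ix 7) X).
Proof.
move=> X0 Y0; have [r4 [r5 [r7 K]]] := lifted_kernel3.
have [X1 X2 X4 X5 X7] := K _ X0; have [Y1 Y2 Y4 Y5 Y7] := K _ Y0.
have [dg [dgP dg0 dg3]] := diff_at_G0_row3 x.
have wd : forall i, is_dform (w i) by case: wc.
rewrite (extd_lifted Am wd _ _ dp dgP) sum8E.
rewrite !(dg0 (ix 4)) ?(dg0 (ix 5)) ?(dg0 (ix 6)) ?(dg0 (ix 7)) ?(dg0 (ix 8)) ?ixE //.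
rewrite !dg3.
case: wS => e1 e2 e3 _ _; rewrite e1 // e2 // e3 // !dformE /=.
rewrite ![G0_mx _ _ _]mxE !ixE //= X1 X2 X4 X5 X7 Y1 Y2 Y4 Y5 Y7 /quintic_dual.
ring.
Qed.

Lemma E3_kernel (X Y : V) :
  {in [:: ix 1; ix 3; ix 4; ix 5; ix 6; ix 8], forall i, th i X = 0} ->
  {in [:: ix 1; ix 3; ix 4; ix 5; ix 6; ix 8], forall i, th i Y = 0} ->
  E3 (lifted_coframe w) Om t c' q (col_mx X Y) =
   (a29 x ^+ 2 / (a38 x ^+ 3 * b7 x * (b5 x * b6 x - 1) ^+ 3)
    * quintic_dual (fun k => u k p) (b5 x) - t (ix 2) (ix 7) q) *
   (th (ix 2) X * th (ix 7) Y - th (ix 2) Y * th (ix 7) X).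
Proof.
move=> X0 Y0; have [a0 a0' a0'' b0 D0] := G0_neq0 xG.
have D0' : b5 x * b6 x - 1 != 0 by rewrite -opprB oppr_eq0.
have S Z : {in [:: ix 1; ix 3; ix 4; ix 5; ix 6; ix 8], forall i, th i Z = 0} ->
    forall i, i != ix 2 -> i != ix 7 -> th i Z = 0.
  move=> Z0; apply: forall_ix8; rewrite ?eqxx // => _ _; apply: Z0;
    by rewrite !inE eqxx ?orbT.
rewrite /E3 !dformE (@torsion_kernel t (ix 2) (ix 7)) ?ixE //; [|exact: S|exact: S].
rewrite (S X X0 (ix 1)) ?(S Y Y0 (ix 1)) ?(S X X0 (ix 3)) ?(S Y Y0 (ix 3))
  ?(S X X0 (ix 4)) ?(S Y Y0 (ix 4)) ?(S X X0 (ix 6)) ?(S Y Y0 (ix 6)) ?ix_eqE //.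
rewrite extd_kernel3 // lifted_wedge_kernel3 //; field.
by rewrite ?a0 ?a0' ?b0 ?D0'.
Qed.
End Coefficients.
End Main.

Section WedgeCriterion.
Variables (R : realType) (M : topologicalType) (A : atlas R 8 M).
Variables (w : 'I_8 -> dform A 1) (u : 'I_12 -> M -> R).
Hypothesis Am : smooth_manifold A.
Hypothesis wc : coframe w.
Hypothesis wS : structure_equations u w.
Variables (c : chart A) (p : M) (x : 'rV[R]_23).
Hypotheses (dp : dom c p) (xG : G0 x).
Variables (Om : 'I_4 -> dform (atlasG0 A) 1).
Variables (t : 'I_8 -> 'I_8 -> M * 'rV[R]_23 -> R).
Hypothesis Omd : forall k, is_dform (Om k).
Local Notation q := (p, x).
Local Notation c' := (c : chart (atlasG0 A)).
Local Notation th k := (lifted_coframe w (ix k)).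

Lemma E2_wedges_eq0 :
  (forall v, (E2 (lifted_coframe w) Om t
     ∧ th 1 ∧ th 2 ∧ th 4 ∧ th 5 ∧ th 7 ∧ th 8) c' q v = 0) <->
  t (ix 3) (ix 6) q = a38 x ^+ 2 * quintic (fun k => u k p) (b6 x)
    / (a29 x ^+ 3 * b7 x * (b5 x * b6 x - 1) ^+ 3).
Proof.
have [e eP] := lifted_coframe_dual wc dp xG.
have us : uniq [:: ix 3; ix 6; ix 1; ix 2; ix 4; ix 5; ix 7; ix 8 : 'I_8].
  by rewrite -(map_inj_uniq val_inj) /= !ixE.
have thl i : lin1 (lifted_coframe w i c' q) by exact: lin1_lifted_coframe.
have Ea : alt2 (E2 (lifted_coframe w) Om t c' q) by apply: alt2_E2; eauto.
have EK := E2_kernel Am wc wS dp xG Om t.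
apply: iff_trans (wedges_eq0 thl eP us Ea EK) _.
by split=> [/eqP|->]; rewrite ?subrr // subr_eq0 => /eqP ->.
Qed.

Lemma E3_wedges_eq0 :
  (forall v, (E3 (lifted_coframe w) Om t
     ∧ th 1 ∧ th 3 ∧ th 4 ∧ th 5 ∧ th 6 ∧ th 8) c' q v = 0) <->
  t (ix 2) (ix 7) q = a29 x ^+ 2 / (a38 x ^+ 3 * b7 x * (b5 x * b6 x - 1) ^+ 3)
    * quintic_dual (fun k => u k p) (b5 x).
Proof.
have [e eP] := lifted_coframe_dual wc dp xG.
have us : uniq [:: ix 2; ix 7; ix 1; ix 3; ix 4; ix 5; ix 6; ix 8 : 'I_8].
  by rewrite -(map_inj_uniq val_inj) /= !ixE.
have thl i : lin1 (lifted_coframe w i c' q) by exact: lin1_lifted_coframe.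
have Ea : alt2 (E3 (lifted_coframe w) Om t c' q) by apply: alt2_E3; eauto.
have EK := E3_kernel Am wc wS dp xG Om t.
apply: iff_trans (wedges_eq0 thl eP us Ea EK) _.
by split=> [/eqP|->]; rewrite ?subrr // subr_eq0 => /eqP ->.
Qed.

End WedgeCriterion.

Theorem proposition3p8 (R : realType) (M : topologicalType) (A : atlas R 8 M)
    (w : 'I_8 -> dform A 1) (u : 'I_12 -> M -> R)
    (Om : 'I_4 -> dform (atlasG0 A) 1)
    (t2 t3 : 'I_8 -> 'I_8 -> M * 'rV[R]_23 -> R) :
  smooth_manifold A ->
  coframe w ->
  (forall k, smooth_fun A (u k)) ->
  structure_equations u w ->
  (forall k, is_dform (Om k)) ->
  (forall i j, smooth_fun (atlasG0 A) (t2 i j)) ->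
  (forall i j, smooth_fun (atlasG0 A) (t3 i j)) ->
  let th k := lifted_coframe w (ix k) in
  let E2 := E2 (lifted_coframe w) Om t2 in
  let E3 := E3 (lifted_coframe w) Om t3 in
  (E2 ∧ th 1%N ∧ th 2%N ∧ th 4%N ∧ th 5%N ∧ th 7%N ∧ th 8%N =f 0
   <->
   eq_on_carrier (atlasG0 A) (t2 (ix 3) (ix 6))
     (fun q => let: (p, x) := q in
        a38 x ^+ 2 * quintic (fun k => u k p) (b6 x)
        / (a29 x ^+ 3 * b7 x * (b5 x * b6 x - 1) ^+ 3)))
  /\
  (E3 ∧ th 1%N ∧ th 3%N ∧ th 4%N ∧ th 5%N ∧ th 6%N ∧ th 8%N =f 0
   <->
   eq_on_carrier (atlasG0 A) (t3 (ix 2) (ix 7))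
     (fun q => let: (p, x) := q in
        a29 x ^+ 2 / (a38 x ^+ 3 * b7 x * (b5 x * b6 x - 1) ^+ 3)
        * quintic_dual (fun k => u k p) (b5 x))).
Proof.
move=> Am wc _ wS Omd _ _ th F2 F3.
have P2 (c : chart A) p x (dp : dom c p) (xG : G0 x) :=
  E2_wedges_eq0 Am wc wS dp xG t2 Omd.
have P3 (c : chart A) p x (dp : dom c p) (xG : G0 x) :=
  E3_wedges_eq0 Am wc wS dp xG t3 Omd.
split; split.
- by move=> H [p x] [c _ [dp xG]]; apply/(P2 c) => // v; exact: H.
- by move=> H c [p x] v [dp xG]; move: v; apply/(P2 c) => //; apply: H; exists c.
- by move=> H [p x] [c _ [dp xG]]; apply/(P3 c) => // v; exact: H.
- by move=> H c [p x] v [dp xG]; move: v; apply/(P3 c) => //; apply: H; exists c.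
Qed.
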